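(* Let $\alpha,\beta>0$ and let $\lambda\in\mathbb{R}$, $a,b>0$ with $-\min\{a,b\}<\frac{\lambda}{2}<\min\{a,b\}$. Let $X,Y$ be independent random variables with $X\sim \mathrm{Be}'(\lambda,a,b;\alpha,1)$ and $Y\sim\mathrm{Be}'(-\lambda,a,b;\beta,1)$, and set $(U,V)=H_I^{+,\alpha,\beta}(X,Y)$. Then $U$ and $V$ are independent, with $U\sim\mathrm{Be}'(-\lambda,a,b;\alpha,1)$ and $V\sim \mathrm{Be}'(\lambda,a,b;\beta,1)$.
   Context: $\mathbb{R}_+=(0,\infty)$. For $\alpha,\beta>0$ the map $H_I^{+,\alpha,\beta}:\mathbb{R}_+^2\to\mathbb{R}_+^2$ is $$H_I^{+,\alpha,\beta}(x,y)=\left(\frac{y}{\alpha}\,\frac{\beta+\alpha x+\beta y+\alpha\beta xy}{1+x+y+\beta xy},\ \frac{x}{\beta}\,\frac{\alpha+\alpha x+\beta y+\alpha\beta xy}{1+x+y+\alpha xy}\right).$$ For $p,q>0$ and $\lambda,a,b\in\mathbb{R}$ with $-b<\frac{\lambda}{2}<a$, the generalized Beta prime distribution $\mathrm{Be}'(\lambda,a,b;p,q)$ is the probability distribution on $\mathbb{R}_+$ with density proportional to $x^{\lambda-1}(1+px)^{-a-\frac{\lambda}{2}}(1+qx^{-1})^{-b+\frac{\lambda}{2}}$, $x\in\mathbb{R}_+$. *)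

(* Defs.v *)
From HB Require Import structures.
From mathcomp Require Import all_boot all_order all_algebra.
From mathcomp Require Import all_classical all_reals all_analysis.
Set Implicit Arguments. Unset Strict Implicit. Unset Printing Implicit Defensive.
Import Order.TTheory GRing.Theory Num.Theory.
Local Open Scope classical_set_scope.
Local Open Scope ring_scope.

(* unnormalized density of Be'(lam,a,b;p,q) at x > 0 *)
Definition gbp_dens {R : realType} (lam a b p q x : R) : R :=
  x `^ (lam - 1) * (1 + p * x) `^ (- a - lam / 2) * (1 + q / x) `^ (- b + lam / 2).

Definition gbp_const {R : realType} (lam a b p q : R) : \bar R :=
  (\int[@lebesgue_measure R]_(x in (`]0%R, +oo[%classic : set R)) (gbp_dens lam a b p q x)%:E)%E.

Definition gbp_law {R : realType} (lam a b p q : R) (A : set R) : \bar R :=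
  ((fine (gbp_const lam a b p q))^-1%:E *
   \int[@lebesgue_measure R]_(x in A `&` (`]0%R, +oo[%classic : set R)) (gbp_dens lam a b p q x)%:E)%E.

Definition has_gbp_law {d} {T : measurableType d} {R : realType}
  (P : probability T R) (X : T -> R) (lam a b p q : R) : Prop :=
  measurable_fun setT X /\
  forall A : set R, measurable A -> P (X @^-1` A) = gbp_law lam a b p q A.

Definition indep_rv {d} {T : measurableType d} {R : realType}
  (P : probability T R) (X Y : T -> R) : Prop :=
  forall A B : set R, measurable A -> measurable B ->
    P (X @^-1` A `&` Y @^-1` B) = (P (X @^-1` A) * P (Y @^-1` B))%E.

Definition HIp {R : realType} (alpha beta : R) (xy : R * R) : R * R :=
  let x := xy.1 in let y := xy.2 in
  (y / alpha * ((beta + alpha * x + beta * y + alpha * beta * x * y)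
                 / (1 + x + y + beta * x * y)),
   x / beta * ((alpha + alpha * x + beta * y + alpha * beta * x * y)
                 / (1 + x + y + alpha * x * y))).

(* Main.v *)
Require Import Defs.
From HB Require Import structures.
From mathcomp Require Import all_boot all_order all_algebra.
From mathcomp Require Import all_classical all_reals all_analysis.
From mathcomp Require Import measurable_realfun ring.
Import Order.TTheory GRing.Theory Num.Theory.
Local Open Scope classical_set_scope.
Local Open Scope ring_scope.

(* Write [w = beta y (1 + alpha x) / (1 + x)]. Then [v = x (alpha + w) / (beta + w)]
   and [u = w (1 + v) / (alpha (1 + beta v))], so that [H_I^+] is a composition
   of three maps, each rescaling one coordinate by a positive function of the
   other one. By Tonelli and the scale invariance of [dx / x], such maps
   preserve [dx dy / (x y)], hence so does [H_I^+]: no two-dimensional Jacobian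
   is needed. With respect to this measure the densities transform pointwise,
   up to the constant [(beta / alpha) ^ lam], because
   [(1 + alpha x) (1 + beta y)] and [(1 + 1/x) (1 + 1/y)] are invariant under
   [H_I^+] and a third quantity is invariant up to a constant. Finiteness of
   the normalizing constants of the laws of [U] and [V], and their product,
   follow from [P] having total mass one. *)

Lemma measurable_funV (d : measure_display) (T : measurableType d)
    (R : realType) (f : T -> R) :
  measurable_fun setT f -> measurable_fun setT (fun t => (f t)^-1).
Proof.
move=> mf.
(* Powers are measurable in their base, and squaring makes the base nonnegative, where the power
   [-1] is the inverse. At a zero of [f] both sides are [0], as [0^-1 = 0]. *)
have -> : (fun t => (f t)^-1) = (fun t => f t * (f t ^+ 2) `^ (-1)).
  apply/funext => t; rewrite powR_inv1 ?sqr_ge0//.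
  have [->|f0] := eqVneq (f t) 0; first by rewrite invr0 mul0r.
  by field.
apply: measurable_funM => //.
apply: (@measurableT_comp _ _ _ _ _ _ (@powR R ^~ (-1)) _ (fun t => f t ^+ 2)) => //.
exact: measurable_funX.
Qed.

(** * Scale invariance of the Haar measure of the multiplicative group *)

Section scaling.
Context {R : realType}.
Notation mu := (@lebesgue_measure R).
Local Open Scope ereal_scope.

(** By uniqueness of Lebesgue measure: the right-hand side is a measure in [A] that gives half-open
    intervals their length. *)
Lemma lebesgue_measure_scale (c : R) (A : set R) : (0 < c)%R -> measurable A ->
  mu A = c%:E * mu [set x | A (c * x)%R].
Proof.
move=> c0 mA.
have mc : measurable_fun [set: measurableTypeR R]
    ((fun x => c * x)%R : measurableTypeR R -> measurableTypeR R).
  exact: mulrl_measurable.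
pose mcE := isMeasurableFun.Build _ _ _ _ _ mc.
pose f : {mfun measurableTypeR R >-> measurableTypeR R} :=
  HB.pack (fun x : R => c * x)%R mcE.
rewrite (@lebesgue_measure_unique R
  (mscale (NngNum (ltW c0))%R (pushforward mu f)))//.
move=> _ [[x y] _ <-] /=.
rewrite /mscale/= /pushforward/=.
rewrite (_ : _ @^-1` _ = `](x / c)%R, (y / c)%R]%classic); last first.
  apply/seteqP; split => z /=; rewrite !in_itv/= => /andP[h1 h2].
    by rewrite ltr_pdivrMr// ler_pdivlMr// ![(z * _)%R]mulrC h1.
  move: h1 h2; rewrite ltr_pdivrMr// ler_pdivlMr// ![(z * _)%R]mulrC.
  by move=> -> ->.
rewrite !lebesgue_measure_itv/= !lte_fin ltr_pM2r ?invr_gt0//.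
case: ifPn => _; last by rewrite mule0.
rewrite -!EFinD -EFinM; congr EFin.
by rewrite -mulrBl mulrCA mulfV ?mulr1// gt_eqF.
Qed.

Lemma ge0_integral_scale (c : R) (f : R -> \bar R) : (0 < c)%R ->
  measurable_fun setT f -> (forall x, 0 <= f x) ->
  \int[mu]_x f x = c%:E * \int[mu]_x f (c * x)%R.
Proof.
move=> c0 mf f0.
have mc : measurable_fun [set: measurableTypeR R]
    ((fun x => c * x)%R : measurableTypeR R -> measurableTypeR R).
  exact: mulrl_measurable.
have := @ge0_integral_pushforward _ _ _ _ R _ mc mu setT f measurableT mf
  (fun x _ => f0 x).
rewrite preimage_setT => /= <-.
rewrite -(ge0_integral_mscale _ measurableT (NngNum (ltW c0)))//.
apply: eq_measure_integral => A mA _.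
exact: lebesgue_measure_scale.
Qed.

(* The density of the Haar measure [dx / x] of the multiplicative group
   [R_+], extended by zero. *)
Definition haar (x : R) : R := (\1_`]0%R, +oo[ x * x^-1)%R.

Lemma haar_ge0 (x : R) : (0 <= haar x)%R.
Proof.
rewrite /haar indicE; case: (boolP (_ \in _)) => [|_]; last by rewrite mul0r.
by rewrite inE/= in_itv/= andbT mul1r invr_ge0 => /ltW.
Qed.

Lemma haar_eq0 (x : R) : (x <= 0)%R -> haar x = 0%R.
Proof.
move=> x0; rewrite /haar indicE memNset ?mul0r//=.
by rewrite in_itv/= andbT; apply/negP; rewrite -leNgt.
Qed.

Lemma haar_gt0 (x : R) : (0 < x)%R -> haar x = x^-1%R.
Proof. by move=> x0; rewrite /haar indicE mem_set ?mul1r//= in_itv/= x0. Qed.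

Lemma measurable_haar : measurable_fun setT haar.
Proof.
apply: measurable_funM; first exact: measurable_indic.
exact: measurable_funV.
Qed.

Lemma haarM (c x : R) : (0 < c)%R -> haar (c * x) = (c^-1 * haar x)%R.
Proof.
move=> c0; have [x0|x0] := leP x 0%R.
  by rewrite !haar_eq0 ?mulr0// pmulr_rle0.
by rewrite !haar_gt0 ?mulr_gt0// invfM.
Qed.

(** The factor [c] from the change of variables cancels the factor [c^-1] by which [haar] scales. *)
Lemma integral_haarM (c : R) (f : R -> \bar R) : (0 < c)%R ->
  measurable_fun setT f -> (forall x, 0 <= f x) ->
  \int[mu]_x (f (c * x)%R * (haar x)%:E) = \int[mu]_x (f x * (haar x)%:E).
Proof.
move=> c0 mf f0.
have mh : measurable_fun setT (fun x => f x * (haar x)%:E).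
  apply: emeasurable_funM => //.
  by apply/measurable_EFinP; exact: measurable_haar.
have h0 x : 0 <= f x * (haar x)%:E by rewrite mule_ge0// lee_fin haar_ge0.
rewrite [RHS](@ge0_integral_scale c)//.
rewrite -ge0_integralZl//; last 2 first.
- apply: (measurableT_comp (f := fun x => f x * (haar x)%:E)) => //.
- by rewrite lee_fin ltW.
apply: eq_integral => x _; rewrite haarM// muleCA -EFinM mulrA divff ?gt_eqF//.
by rewrite mul1r.
Qed.

(** Integration against [dx dy / (x y)], written as an iterated integral so that a rescaling of the
    second coordinate takes place inside the inner integral. *)
Definition haar2 (F : R * R -> \bar R) : \bar R :=
  \int[mu]_x \int[mu]_y (F (x, y) * (haar x * haar y)%:E).

Lemma measurable_haar2 (F : R * R -> \bar R) : measurable_fun setT F ->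
  measurable_fun setT (fun z => F z * (haar z.1 * haar z.2)%:E).
Proof.
move=> mF; apply: emeasurable_funM => //; apply/measurable_EFinP.
by apply: measurable_funM; apply: (measurableT_comp measurable_haar).
Qed.

Lemma haar2_ge0 (F : R * R -> \bar R) : (forall z, 0 <= F z) ->
  forall z, 0 <= F z * (haar z.1 * haar z.2)%:E.
Proof. by move=> F0 z; rewrite mule_ge0// lee_fin mulr_ge0// haar_ge0. Qed.

Lemma haar2_swap (F : R * R -> \bar R) : measurable_fun setT F ->
  (forall z, 0 <= F z) -> haar2 F = haar2 (fun z => F (z.2, z.1)).
Proof.
move=> mF F0; rewrite /haar2.
rewrite (@fubini_tonelli _ _ _ _ _ mu mu
  (fun z => F z * (haar z.1 * haar z.2)%:E))/=.
- by apply: eq_integral => x _; apply: eq_integral => y _; rewrite mulrC.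
- exact: measurable_haar2.
- exact: haar2_ge0.
Qed.

(** For fixed [x] the factor [c x] is a constant, so the one-dimensional invariance applies to the
    inner integral. *)
Lemma haar2_scale_snd (c : R -> R) (F : R * R -> \bar R) :
  (forall x, 0 < x -> 0 < c x)%R -> measurable_fun setT F ->
  (forall z, 0 <= F z) ->
  haar2 (fun z => F (z.1, (c z.1 * z.2)%R)) = haar2 F.
Proof.
move=> c0 mF F0; apply: eq_integral => x _ /=.
(* For [x <= 0] the sign of [c x] is unknown, but the weight [haar x] vanishes. *)
have [x0|x0] := leP x 0%R.
  by rewrite !integral0_eq// => y _; rewrite (haar_eq0 _ x0) mul0r mule0.
have assoc (G : R -> \bar R) y :
    G y * (haar x * haar y)%:E = (G y * (haar x)%:E) * (haar y)%:E.
  by rewrite EFinM muleA.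
under eq_integral do rewrite (assoc (fun y => F (x, (c x * y)%R))).
under [RHS]eq_integral do rewrite (assoc (fun y => F (x, y))).
apply: (@integral_haarM (c x) (fun y => F (x, y) * (haar x)%:E)).
- exact: c0.
- apply: emeasurable_funM => //.
  exact: (measurableT_comp mF).
- by move=> y; rewrite mule_ge0// lee_fin haar_ge0.
Qed.

(** Conjugating by the swap of coordinates reduces this to a rescaling of the second one. *)
Lemma haar2_scale_fst (c : R -> R) (F : R * R -> \bar R) :
  (forall y, 0 < y -> 0 < c y)%R -> measurable_fun setT c ->
  measurable_fun setT F -> (forall z, 0 <= F z) ->
  haar2 (fun z => F ((c z.2 * z.1)%R, z.2)) = haar2 F.
Proof.
move=> c0 mc mF F0; rewrite haar2_swap//; last first.
  apply: (measurableT_comp mF); apply: measurable_fun_pair => //.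
  by apply: measurable_funM => //; exact: measurableT_comp.
rewrite [RHS]haar2_swap//=.
rewrite (@haar2_scale_snd c (fun z => F (z.2, z.1)))//.
by apply: (measurableT_comp mF); exact: measurable_fun_pair.
Qed.

End scaling.

(** * Joint density of two independent variables *)

Section joint_density.
Context {R : realType}.
Notation mu := (@lebesgue_measure R).
Local Open Scope ereal_scope.

Lemma integral2_prod (f g : R -> R) :
  measurable_fun setT f -> measurable_fun setT g ->
  (forall x, 0 <= f x)%R -> (forall x, 0 <= g x)%R ->
  \int[mu]_x \int[mu]_y (f x * g y)%:E =
  (\int[mu]_x (f x)%:E) * \int[mu]_y (g y)%:E.
Proof.
move=> mf mg f0 g0.
transitivity (\int[mu]_x ((f x)%:E * \int[mu]_y (g y)%:E)).
  apply: eq_integral => x _; under eq_integral do rewrite EFinM.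
  by rewrite ge0_integralZl// ?lee_fin//; [exact/measurable_EFinP|
    move=> y _; rewrite lee_fin].
rewrite ge0_integralZr//.
- exact/measurable_EFinP.
- by move=> x _; rewrite lee_fin.
- by apply: integral_ge0 => y _; rewrite lee_fin.
Qed.

(** The law of [(X, Y)] and the measure with density [f x * g y] both agree on rectangles with the
    product of the marginal laws, the former by independence. Uniqueness of the product measure
    extends this to every measurable [C]. *)
Lemma indep_joint_density (d : measure_display) (T : measurableType d)
    (P : probability T R) (X Y : T -> R) (f g : R -> R) :
  measurable_fun setT X -> measurable_fun setT Y ->
  measurable_fun setT f -> measurable_fun setT g ->
  (forall x, 0 <= f x)%R -> (forall x, 0 <= g x)%R ->
  (forall A, measurable A ->
    P (X @^-1` A) = \int[mu]_x (\1_A x * f x)%:E) ->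
  (forall A, measurable A ->
    P (Y @^-1` A) = \int[mu]_x (\1_A x * g x)%:E) ->
  indep_rv P X Y ->
  forall C : set (R * R), measurable C ->
    P [set t | C (X t, Y t)] =
    \int[mu]_x \int[mu]_y (\1_C (x, y) * (f x * g y))%:E.
Proof.
move=> mX mY mf mg f0 g0 PX PY indepXY C mC.
pose X' : {mfun T >-> R} := HB.pack X (isMeasurableFun.Build _ _ _ _ X mX).
pose Y' : {mfun T >-> R} := HB.pack Y (isMeasurableFun.Build _ _ _ _ Y mY).
have mXY : measurable_fun setT (fun t => (X t, Y t)).
  exact: measurable_fun_pair.
pose XY : {mfun T >-> (R * R)%type} :=
  HB.pack (fun t => (X t, Y t)) (isMeasurableFun.Build _ _ _ _ _ mXY).
have mfg : measurable_fun setT (fun z : R * R => (f z.1 * g z.2)%:E).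
  apply/measurable_EFinP.
  by apply: measurable_funM; exact: measurableT_comp.
have fg0 z : 0 <= (f z.1 * g z.2)%:E by rewrite lee_fin mulr_ge0.
(* [Q] is made into a measure so that the uniqueness theorem applies to it; [QE] turns it back into
   an iterated integral. *)
pose Q (A : set (R * R)) := \int[(mu \x mu)%E]_(z in A) (f z.1 * g z.2)%:E.
have Q0 : Q set0 = 0 by rewrite /Q integral_set0.
have Qge0 A : 0 <= Q A by apply: integral_ge0.
have Qsigma : semi_sigma_additive Q.
  move=> F mF tF mUF; rewrite /Q ge0_integral_bigcup//.
    apply: is_cvg_ereal_nneg_natsum_cond => n _ _.
    by apply: integral_ge0.
  exact: measurable_funTS.
pose Qm : {measure set (R * R) -> \bar R} :=
  HB.pack Q (isMeasure.Build _ _ _ Q Q0 Qge0 Qsigma).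
have QE A : measurable A ->
    Q A = \int[mu]_x \int[mu]_y (\1_A (x, y) * (f x * g y))%:E.
  move=> mA; rewrite /Q integral_mkcond.
  have E z : ((fun z => (f z.1 * g z.2)%:E) \_ A) z =
      (\1_A z * (f z.1 * g z.2))%:E.
    by rewrite patchE indicE; case: ifPn; rewrite ?mul1r ?mul0r.
  under eq_integral do rewrite E.
  rewrite fubini_tonelli1//.
  - apply/measurable_EFinP; apply: measurable_funM.
      exact: measurable_indic.
    exact/measurable_EFinP.
  - by move=> z; rewrite EFinM mule_ge0// lee_fin.
rewrite -QE//.
transitivity ((distribution P X' \x distribution P Y') C).
  by rewrite (@product_measure_unique _ _ _ _ _ _ _ (distribution P XY)).
rewrite (@product_measure_unique _ _ _ _ _ _ _ Qm)// => A B mA mB.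
rewrite /= QE; last exact: measurableX.
rewrite /distribution /pushforward/= PX// PY//.
rewrite -integral2_prod.
- apply: eq_integral => x _; apply: eq_integral => y _.
  by rewrite !indicE in_setX/= -mulnb natrM; congr EFin; ring.
- by apply: measurable_funM => //; exact: measurable_indic.
- by apply: measurable_funM => //; exact: measurable_indic.
- by move=> x; rewrite mulr_ge0.
- by move=> x; rewrite mulr_ge0.
Qed.

End joint_density.

(** The unnormalized density for [q = 1], taken with respect to [dt / t]: hence the exponent [lam]
    in place of [lam - 1]. *)
Definition gbp_haar_dens {R : realType} (lam a b p t : R) : R :=
  t `^ lam * (1 + p * t) `^ (- a - lam / 2) * (1 + 1 / t) `^ (- b + lam / 2).

(** * Algebraic identities for [HIp] and the pointwise transformation of densities *)

Section algebra.
Context {R : realType}.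
Variables (alpha beta x y : R).
Hypotheses (a0 : 0 < alpha) (b0 : 0 < beta) (x0 : 0 < x) (y0 : 0 < y).

Let U := (HIp alpha beta (x, y)).1.
Let V := (HIp alpha beta (x, y)).2.

Let D1 : 0 < 1 + x + y + beta * x * y.
Proof. by rewrite !addr_gt0 ?mulr_gt0. Qed.

Let D2 : 0 < 1 + x + y + alpha * x * y.
Proof. by rewrite !addr_gt0 ?mulr_gt0. Qed.

Let N1 : 0 < beta + alpha * x + beta * y + alpha * beta * x * y.
Proof. by rewrite !addr_gt0 ?mulr_gt0. Qed.

Let N2 : 0 < alpha + alpha * x + beta * y + alpha * beta * x * y.
Proof. by rewrite !addr_gt0 ?mulr_gt0. Qed.

Lemma HIp1_gt0 : 0 < U.
Proof. by rewrite /U /HIp/= !mulr_gt0 ?invr_gt0. Qed.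

Lemma HIp2_gt0 : 0 < V.
Proof. by rewrite /V /HIp/= !mulr_gt0 ?invr_gt0. Qed.

(* [H_I^+] factors as [(x, y) -> (x, w) -> (v, w) -> (v, u) -> (u, v)], where
   each of the first three maps rescales one coordinate by a positive function
   of the other one. *)
Lemma HIp_scalings :
  let w := beta * (1 + alpha * x) * (1 + x)^-1 * y in
  let v := (alpha + w) * (beta + w)^-1 * x in
  HIp alpha beta (x, y) = ((1 + v) * (alpha * (1 + beta * v))^-1 * w, v).
Proof.
rewrite /HIp/=; congr pair; field.
  by rewrite !gt_eqF//; repeat (apply: addr_gt0 || apply: mulr_gt0 || by []).
by rewrite !gt_eqF//; repeat (apply: addr_gt0 || apply: mulr_gt0 || by []).
Qed.

Lemma HIp_invariant_1D :
  (1 + alpha * U) * (1 + beta * V) = (1 + alpha * x) * (1 + beta * y).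
Proof.
rewrite /U /V /HIp/=; field.
by rewrite !gt_eqF.
Qed.

Lemma HIp_invariant_1DV :
  (1 + 1 / U) * (1 + 1 / V) = (1 + 1 / x) * (1 + 1 / y).
Proof.
rewrite /U /V /HIp/=; field.
by rewrite !gt_eqF.
Qed.

(** For [q(s, t) = s^2 (1 + 1/s) (1 + beta t) / (t^2 (1 + 1/t) (1 + alpha s))] this reads
    [q(x, y) q(U, V) = (beta / alpha)^2], cleared of denominators. The product of densities depends
    on [lam] through [q^(lam / 2)] at [(x, y)] and [q^(- lam / 2)] at [(U, V)]. *)
Lemma HIp_invariant_ratio :
  (alpha ^+ 2 * (x ^+ 2 * ((1 + 1 / x) * (1 + beta * y)))) *
    (U ^+ 2 * ((1 + 1 / U) * (1 + beta * V))) =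
  (beta ^+ 2 * (V ^+ 2 * ((1 + 1 / V) * (1 + alpha * U)))) *
    (y ^+ 2 * ((1 + 1 / y) * (1 + alpha * x))).
Proof.
rewrite /U /V /HIp/=; field.
by rewrite !gt_eqF.
Qed.

Let gbp_haar_densE (lam a b p t : R) : 0 < p -> 0 < t ->
  gbp_haar_dens lam a b p t = expR (lam * ln t +
    (- a - lam / 2) * ln (1 + p * t) + (- b + lam / 2) * ln (1 + 1 / t)).
Proof.
move=> p0 t0; rewrite !expRD /gbp_haar_dens /powR !gt_eqF//.
- by rewrite addr_gt0 ?divr_gt0.
- by rewrite addr_gt0 ?mulr_gt0.
Qed.

Lemma gbp_haar_dens_HIp (lam a b : R) :
  gbp_haar_dens lam a b alpha x * gbp_haar_dens (- lam) a b beta y =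
  (beta / alpha) `^ lam *
  (gbp_haar_dens (- lam) a b alpha U * gbp_haar_dens lam a b beta V).
Proof.
have := HIp_invariant_ratio; have := HIp_invariant_1DV.
have := HIp_invariant_1D; have := HIp2_gt0; have := HIp1_gt0.
(* From here on the images enter only through their positivity and the logarithms of the three
   identities. *)
move: U V => u v u0 v0 /(congr1 (@ln R)) E1 /(congr1 (@ln R)) E2.
move=> /(congr1 (@ln R)) E3.
rewrite !gbp_haar_densE//.
rewrite [(beta / alpha) `^ lam]/powR gt_eqF ?divr_gt0// -!expRD; congr expR.
have pD (p t : R) : 0 < p -> 0 < t -> 1 + p * t \is Num.pos.
  by move=> p0 t0; rewrite posrE addr_gt0 ?mulr_gt0.
have pV (t : R) : 0 < t -> 1 + 1 / t \is Num.pos.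
  by move=> t0; rewrite posrE addr_gt0 ?divr_gt0.
have pM (s t : R) : s \is Num.pos -> t \is Num.pos -> s * t \is Num.pos.
  by rewrite !posrE => s0 t0; rewrite mulr_gt0.
rewrite !lnM ?pD// in E1.
rewrite !lnM ?pV// in E2.
rewrite !expr2 !lnM ?pM ?pV ?pD ?posrE// in E3.
rewrite lnM ?posrE ?invr_gt0// lnV ?posrE//.
apply/eqP; rewrite -subr_eq0; apply/eqP.
move: E1 E2 E3.
set l1 := ln (1 + alpha * u); set l2 := ln (1 + beta * v).
set l3 := ln (1 + alpha * x); set l4 := ln (1 + beta * y).
set l5 := ln (1 + 1 / u); set l6 := ln (1 + 1 / v).
set l7 := ln (1 + 1 / x); set l8 := ln (1 + 1 / y).
move=> E1 E2 E3.
(* The difference of the exponents is a linear combination of the three logarithmic identities, with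
   coefficients [a], [b] and [lam / 2]. *)
transitivity (a * (l1 + l2 - (l3 + l4)) + b * (l5 + l6 - (l7 + l8)) +
  lam / 2 * ((ln alpha + ln alpha + (ln x + ln x + (l7 + l4)) +
    (ln u + ln u + (l5 + l2))) - (ln beta + ln beta + (ln v + ln v + (l6 + l1)) +
    (ln y + ln y + (l8 + l3))))).
  by field.
by rewrite E1 E2 E3 !subrr !mulr0 !addr0.
Qed.

End algebra.

(** * Invariance of [haar2] under [HIp], and the laws as Haar integrals *)

Section transport.
Context {R : realType}.
Notation mu := (@lebesgue_measure R).
Local Open Scope ereal_scope.

Lemma measurable_HIp (alpha beta : R) : measurable_fun setT (HIp alpha beta).
Proof.
have mx : measurable_fun setT (@fst R R) by exact: measurable_fst.
have my : measurable_fun setT (@snd R R) by exact: measurable_snd.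
apply: measurable_fun_pair => /=.
  by repeat (apply: measurable_funM || apply: measurable_funD ||
             apply: measurable_funV || by []).
by repeat (apply: measurable_funM || apply: measurable_funD ||
           apply: measurable_funV || by []).
Qed.

Lemma haar2_HIp (alpha beta : R) (F : R * R -> \bar R) :
  (0 < alpha)%R -> (0 < beta)%R ->
  measurable_fun setT F -> (forall z, 0 <= F z) ->
  haar2 (fun z => F (HIp alpha beta z)) = haar2 F.
Proof.
move=> a0 b0 mF F0.
pose c1 (x : R) : R := (beta * (1 + alpha * x) * (1 + x)^-1)%R.
pose c2 (w : R) : R := ((alpha + w) * (beta + w)^-1)%R.
pose c3 (v : R) : R := ((1 + v) * (alpha * (1 + beta * v))^-1)%R.
have c1_gt0 x : (0 < x)%R -> (0 < c1 x)%R.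
  by move=> x0; rewrite /c1 !mulr_gt0 ?invr_gt0 ?addr_gt0 ?mulr_gt0.
have c2_gt0 x : (0 < x)%R -> (0 < c2 x)%R.
  by move=> x0; rewrite /c2 !mulr_gt0 ?invr_gt0 ?addr_gt0 ?mulr_gt0.
have c3_gt0 x : (0 < x)%R -> (0 < c3 x)%R.
  by move=> x0; rewrite /c3 mulr_gt0 ?invr_gt0 ?mulr_gt0 ?addr_gt0 ?mulr_gt0.
have mid : measurable_fun setT (fun x : R => x) by [].
have mc2 : measurable_fun setT c2.
  by repeat (apply: measurable_funM || apply: measurable_funD ||
             apply: measurable_funV || by []).
have mc3 : measurable_fun setT c3.
  by repeat (apply: measurable_funM || apply: measurable_funD ||
             apply: measurable_funV || by []).
(* [F] is pulled back through the factors of [HIp] from the last to the first: the swap, then the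
   scalings by [c3], [c2] and finally [c1]. *)
pose G1 (z : R * R) := F (z.2, z.1).
have G1_ge0 z : 0 <= G1 z by exact: F0.
have mG1 : measurable_fun setT G1.
  by apply: (measurableT_comp mF); exact: measurable_fun_pair.
pose G2 (z : R * R) := G1 (z.1, c3 z.1 * z.2)%R.
have G2_ge0 z : 0 <= G2 z by exact: G1_ge0.
have mG2 : measurable_fun setT G2.
  apply: (measurableT_comp mG1); apply: measurable_fun_pair => //.
  by apply: measurable_funM => //; exact: measurableT_comp.
pose G3 (z : R * R) := G2 (c2 z.2 * z.1, z.2)%R.
have G3_ge0 z : 0 <= G3 z by exact: G2_ge0.
have mG3 : measurable_fun setT G3.
  apply: (measurableT_comp mG2); apply: measurable_fun_pair => //.
  by apply: measurable_funM => //; exact: measurableT_comp.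
have E1 : haar2 F = haar2 G1 := haar2_swap F mF F0.
have E2 : haar2 G2 = haar2 G1 := haar2_scale_snd c3 G1 c3_gt0 mG1 G1_ge0.
have E3 : haar2 G3 = haar2 G2 := haar2_scale_fst c2 G2 c2_gt0 mc2 mG2 G2_ge0.
rewrite E1 -E2 -E3 -(haar2_scale_snd c1 G3 c1_gt0 mG3 G3_ge0).
apply: eq_integral => x _; apply: eq_integral => y _ /=.
(* The factorization of [HIp] is available for positive coordinates; elsewhere [haar] annihilates
   both sides. *)
have [x0|x0] := leP x 0%R; first by rewrite (haar_eq0 _ x0) mul0r !mule0.
have [y0|y0] := leP y 0%R; first by rewrite (haar_eq0 _ y0) mulr0 !mule0.
by rewrite HIp_scalings.
Qed.

Lemma gbp_haar_dens_ge0 (lam a b p t : R) : (0 <= gbp_haar_dens lam a b p t)%R.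
Proof. by rewrite /gbp_haar_dens !mulr_ge0 ?powR_ge0. Qed.

Lemma measurable_gbp_haar_dens (lam a b p : R) :
  measurable_fun setT (gbp_haar_dens lam a b p).
Proof.
have mpow (r : R) (f : R -> R) : measurable_fun setT f ->
    measurable_fun setT (fun t => f t `^ r)%R.
  by move=> mf; exact: (measurableT_comp (@measurable_powR R r)).
have mid : measurable_fun setT (fun x : R => x) by [].
by repeat (apply: measurable_funM || apply: mpow || apply: measurable_funD ||
           apply: measurable_funV || by []).
Qed.

Lemma haar_gbp_dens (lam a b p x : R) : (0 < x)%R ->
  (haar x * gbp_haar_dens lam a b p x = gbp_dens lam a b p 1 x)%R.
Proof.
move=> x0; rewrite haar_gt0// /gbp_haar_dens /gbp_dens.
have -> : (x `^ (lam - 1) = x `^ lam / x)%R.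
  by rewrite powRB ?powRr1 ?ltW// (gt_eqF x0) implybT.
by rewrite !mulrA; congr (_ * _ * _)%R; rewrite mulrC.
Qed.

(** Since [haar] is extended by zero, the restriction to the half-line is absorbed in the integrand
    and the integral runs over all of [R]. *)
Lemma integral_gbp_dens (lam a b p : R) (A : set R) :
  \int[mu]_(x in A `&` (`]0%R, +oo[%classic : set R))
    (gbp_dens lam a b p 1 x)%:E =
  \int[mu]_x (\1_A x * (haar x * gbp_haar_dens lam a b p x))%:E.
Proof.
rewrite integral_mkcond; apply: eq_integral => x _.
rewrite patchE in_setI indicE.
have [x0|x0] := leP x 0%R.
  rewrite haar_eq0// mul0r mulr0.
  rewrite [x \in `]0%R, +oo[%classic]memNset ?andbF//=.
  by rewrite in_itv/= andbT; apply/negP; rewrite -leNgt.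
rewrite haar_gbp_dens// [x \in `]0%R, +oo[%classic]mem_set ?andbT; last first.
  by rewrite /= in_itv/= x0.
by case: (x \in A); rewrite ?mul1r ?mul0r.
Qed.

Lemma gbp_constE (lam a b p : R) : gbp_const lam a b p 1 =
  \int[mu]_x (\1_setT x * (haar x * gbp_haar_dens lam a b p x))%:E.
Proof. by rewrite -integral_gbp_dens setTI. Qed.

Lemma gbp_lawE (lam a b p : R) (A : set R) : gbp_law lam a b p 1 A =
  (fine (gbp_const lam a b p 1))^-1%:E *
  \int[mu]_x (\1_A x * (haar x * gbp_haar_dens lam a b p x))%:E.
Proof. by rewrite -integral_gbp_dens. Qed.

End transport.

(** * Normalization and the laws of [U] and [V] *)

(** A zero factor makes the product [0], even against [+oo], and an infinite factor among positive
    ones makes it [+oo]. So a product equal to one forces finite nonzero factors. *)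
Lemma mule3_eq1 {R : realType} (k : R) (x y : \bar R) :
  (0 <= k)%R -> (0 <= x)%E -> (0 <= y)%E -> (k%:E * x * y = 1)%E ->
  exists r s : R, [/\ x = r%:E, y = s%:E, r != 0, s != 0 & k = r^-1 * s^-1].
Proof.
rewrite le_eqVlt => /orP[/eqP <-|k0].
  by rewrite !mul0e => _ _ /eqP; rewrite lt_eqF.
case: x => [r| |//] x0; case: y => [s| |//] y0.
- rewrite -!EFinM => -[krs1].
  have r0 : r != 0.
    by apply/eqP => r0; move/eqP: krs1; rewrite r0 mulr0 mul0r eq_sym oner_eq0.
  have s0 : s != 0.
    by apply/eqP => s0; move/eqP: krs1; rewrite s0 mulr0 eq_sym oner_eq0.
  exists r, s; split => //.
  by apply: (mulIf r0); apply: (mulIf s0); rewrite krs1; field; rewrite ?r0 ?s0.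
- move: x0; rewrite lee_fin le_eqVlt => /orP[/eqP <-|r0].
    by rewrite mule0 mul0e => /eqP; rewrite lt_eqF.
  by rewrite -EFinM gt0_muley// lte_fin mulr_gt0.
- rewrite gt0_muley ?lte_fin//.
  move: y0; rewrite lee_fin le_eqVlt => /orP[/eqP <-|s0].
    by rewrite mule0 => /eqP; rewrite lt_eqF.
  by rewrite gt0_mulye.
- by rewrite (@gt0_muley _ k%:E) ?lte_fin// mulyy.
Qed.

Theorem theorem1p1 (d : measure_display) (T : measurableType d) (R : realType)
  (P : probability T R) (X Y : T -> R) (alpha beta lam a b : R) :
  0 < alpha -> 0 < beta -> 0 < a -> 0 < b ->
  - Num.min a b < lam / 2 -> lam / 2 < Num.min a b ->
  has_gbp_law P X lam a b alpha 1 ->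
  has_gbp_law P Y (- lam) a b beta 1 ->
  indep_rv P X Y ->
  let U := fun t => (HIp alpha beta (X t, Y t)).1 in
  let V := fun t => (HIp alpha beta (X t, Y t)).2 in
  [/\ indep_rv P U V,
      has_gbp_law P U (- lam) a b alpha 1 &
      has_gbp_law P V lam a b beta 1].
Proof.
move=> alpha0 beta0 _ _ _ _ [mX PX] [mY PY] indepXY U V.
pose mu := @lebesgue_measure R.
pose I l p A := (\int[mu]_x (\1_A x * (haar x * gbp_haar_dens l a b p x))%:E)%E.
have mI l p (A : set R) : measurable A -> measurable_fun setT
    (fun x => \1_A x * (haar x * gbp_haar_dens l a b p x)).
  move=> mA; apply: measurable_funM; first exact: measurable_indic.
  apply: measurable_funM; first exact: measurable_haar.
  exact: measurable_gbp_haar_dens.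
have hg_ge0 l p x : 0 <= haar x * gbp_haar_dens l a b p x.
  by apply: mulr_ge0; [exact: haar_ge0|exact: gbp_haar_dens_ge0].
have indic_ge0 (A : set R) x : 0 <= \1_A x :> R by rewrite indicE ler0n.
have I_ge0 l p A x : 0 <= \1_A x * (haar x * gbp_haar_dens l a b p x).
  exact: mulr_ge0.
have const_ge0 l p : 0 <= (fine (gbp_const l a b p 1))^-1.
  rewrite invr_ge0 fine_ge0// gbp_constE integral_ge0// => x _.
  by rewrite lee_fin.
pose k1 := (fine (gbp_const lam a b alpha 1))^-1.
pose k2 := (fine (gbp_const (- lam) a b beta 1))^-1.
(* The normalizing constants of [X] and [Y], times the factor by which the densities change under
   [HIp]. Only [0 <= k] is known at first, since [fine] sends [+oo] to [0]. *)
pose k := k1 * k2 * (beta / alpha) `^ lam.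
have k_ge0 : 0 <= k by rewrite !mulr_ge0 ?powR_ge0 ?const_ge0.
have mUV : measurable_fun setT (fun t => HIp alpha beta (X t, Y t)).
  apply: (measurableT_comp (measurable_HIp alpha beta)).
  exact: measurable_fun_pair.
have mU : measurable_fun setT U by exact: (measurableT_comp measurable_fst).
have mV : measurable_fun setT V by exact: (measurableT_comp measurable_snd).
have densE l p (A : set R) : measurable A -> gbp_law l a b p 1 A =
    (\int[mu]_x (\1_A x * ((fine (gbp_const l a b p 1))^-1 *
      (haar x * gbp_haar_dens l a b p x)))%:E)%E.
  move=> mA; rewrite gbp_lawE -ge0_integralZl//.
  - by apply: eq_integral => x _; rewrite -EFinM mulrCA.
  - by apply/measurable_EFinP; exact: mI.
  - by move=> x _; rewrite lee_fin I_ge0.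
  - by rewrite lee_fin const_ge0.
have mdens l p : measurable_fun setT (fun x =>
    (fine (gbp_const l a b p 1))^-1 * (haar x * gbp_haar_dens l a b p x)).
  apply: measurable_funM => //; apply: measurable_funM.
    exact: measurable_haar.
  exact: measurable_gbp_haar_dens.
have dens_ge0 l p x :
    0 <= (fine (gbp_const l a b p 1))^-1 * (haar x * gbp_haar_dens l a b p x).
  exact: mulr_ge0.
(* The joint law of [(U, V)] already factors here, with the constant [k] still to be split between
   the two marginals. *)
have joint A B : measurable A -> measurable B ->
    (P (U @^-1` A `&` V @^-1` B) = k%:E * I (- lam)%R alpha A * I lam beta B)%E.
  move=> mA mB.
  pose C := HIp alpha beta @^-1` (A `*` B).
  have mC : measurable C.
    rewrite -[C]setTI; apply: (measurable_HIp alpha beta) => //.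
    exact: measurableX.
  have := @indep_joint_density R _ T P X Y _ _ mX mY (mdens lam alpha)
    (mdens (- lam) beta) (dens_ge0 _ _) (dens_ge0 _ _) _ _ indepXY C mC.
  rewrite (_ : [set t | C (X t, Y t)] = U @^-1` A `&` V @^-1` B)// => ->;
    last 2 first.
  - by move=> D mD; rewrite PX// densE.
  - by move=> D mD; rewrite PY// densE.
  (* The density of [(U, V)] with respect to [dx dy / (x y)], cut down to the rectangle; its
     composition with [HIp] is the density of [(X, Y)] cut down to [C]. *)
  pose F (z : R * R) := ((\1_A z.1 * (k * gbp_haar_dens (- lam) a b alpha z.1)) *
    (\1_B z.2 * gbp_haar_dens lam a b beta z.2))%:E.
  transitivity (haar2 (fun z => F (HIp alpha beta z))).
    apply: eq_integral => x _; apply: eq_integral => y _.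
    have [x0|x0] := leP x 0.
      by rewrite (haar_eq0 _ x0) !(mul0r, mulr0, mule0).
    have [y0|y0] := leP y 0.
      by rewrite (haar_eq0 _ y0) !(mul0r, mulr0, mule0).
    rewrite /F -EFinM; congr EFin.
    transitivity (k1 * k2 * \1_C (x, y) * (haar x * haar y) *
      (gbp_haar_dens lam a b alpha x * gbp_haar_dens (- lam) a b beta y)).
      by rewrite -/k1 -/k2; ring.
    rewrite gbp_haar_dens_HIp//.
    have -> : \1_C (x, y) = \1_A (HIp alpha beta (x, y)).1 *
        \1_B (HIp alpha beta (x, y)).2 :> R.
      rewrite !indicE -natrM mulnb; congr (_%:R); congr nat_of_bool.
      by rewrite -in_setX; apply/idP/idP; rewrite !inE.
    by rewrite /k; ring.
  rewrite haar2_HIp//; last 2 first.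
  - apply/measurable_EFinP; apply: measurable_funM; apply: measurable_funM.
    + by apply: measurableT_comp => //; exact: measurable_indic.
    + apply: measurable_funM => //.
      by apply: measurableT_comp => //; exact: measurable_gbp_haar_dens.
    + by apply: measurableT_comp => //; exact: measurable_indic.
    + by apply: measurableT_comp => //; exact: measurable_gbp_haar_dens.
  - move=> z; rewrite lee_fin; apply: mulr_ge0; apply: mulr_ge0 => //.
      by apply: mulr_ge0 => //; exact: gbp_haar_dens_ge0.
    exact: gbp_haar_dens_ge0.
  have -> : (k%:E * I (- lam)%R alpha A = \int[mu]_x (k * (\1_A x *
      (haar x * gbp_haar_dens (- lam) a b alpha x)))%:E)%E.
    rewrite /I -ge0_integralZl//.
    - by apply/measurable_EFinP; exact: mI.
    - by move=> x _; rewrite lee_fin I_ge0.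
  rewrite -integral2_prod.
  - apply: eq_integral => x _; apply: eq_integral => y _.
    by rewrite /F -EFinM; congr EFin => /=; ring.
  - by apply: measurable_funM => //; exact: mI.
  - exact: mI.
  - by move=> x; rewrite mulr_ge0 ?I_ge0.
  - by move=> x; rewrite I_ge0.
(* Taking both sets to be the whole line, total mass one identifies [k] as the product of the
   inverse normalizing constants for [U] and [V]. *)
have [r [s [Ir Is r0 s0 kE]]] : exists r s : R, [/\ I (- lam) alpha setT = r%:E,
    I lam beta setT = s%:E, r != 0, s != 0 & k = r^-1 * s^-1].
  apply: mule3_eq1 => //.
  - by apply: integral_ge0 => x _; rewrite lee_fin I_ge0.
  - by apply: integral_ge0 => x _; rewrite lee_fin I_ge0.
  - by rewrite -joint// !preimage_setT setIT probability_setT.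
have lawU A : gbp_law (- lam) a b alpha 1 A = (r^-1%:E * I (- lam)%R alpha A)%E.
  by rewrite gbp_lawE gbp_constE -/(I _ _ _) Ir.
have lawV A : gbp_law lam a b beta 1 A = (s^-1%:E * I lam beta A)%E.
  by rewrite gbp_lawE gbp_constE -/(I _ _ _) Is.
have joint_law A B : measurable A -> measurable B ->
    (P (U @^-1` A `&` V @^-1` B) =
     gbp_law (- lam)%R a b alpha 1%R A * gbp_law lam a b beta 1%R B)%E.
  move=> mA mB; rewrite joint// lawU lawV kE EFinM !muleA.
  by rewrite [(_ * s^-1%:E * _)%E]muleAC.
(* The marginal comes from the whole line in the other coordinate, whose factor is
   [s^-1 * s = 1]. *)
have PU A : measurable A -> P (U @^-1` A) = gbp_law (- lam) a b alpha 1 A.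
  move=> mA; have := joint_law A setT mA measurableT.
  by rewrite preimage_setT setIT lawV Is -EFinM mulVf// mule1.
have PV A : measurable A -> P (V @^-1` A) = gbp_law lam a b beta 1 A.
  move=> mA; have := joint_law setT A measurableT mA.
  by rewrite preimage_setT setTI lawU Ir -EFinM mulVf// mul1e.
split; [move=> A B mA mB|by split|by split].
by rewrite joint_law// PU// PV.
Qed.
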